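(* Let $k\ge 7$ and $\ell\ge 10^7 k^6$ be integers, and suppose that $k$ is the smallest integer greater than $2$ that does not divide $\ell$. Then for every $\eta>0$ there exists an integer $n_1=n_1(\eta,\ell)$ such that every oriented graph $G$ on $n\ge n_1$ vertices with minimum semidegree $\delta^0(G)\ge (1+\eta)n/k$ contains an $\ell$-cycle.
   Context: An oriented graph is a directed graph obtained from a simple undirected graph by giving each edge a direction (so there are no loops and at most one edge between any two vertices). The minimum semidegree $\delta^0(G)$ is the minimum of the minimum outdegree $\delta^+(G)$ and the minimum indegree $\delta^-(G)$. An $\ell$-cycle is a directed cycle (all edges oriented consistently) of length exactly $\ell$. *)

(* Defs.v *)
From mathcomp Require Import all_boot all_order all_algebra reals.

Set Implicit Arguments.
Unset Strict Implicit.
Unset Printing Implicit Defensive.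

Definition oriented_graph (T : finType) (e : rel T) : Prop :=
  irreflexive e /\ forall x y : T, e x y -> ~~ e y x.

Definition outdegree (T : finType) (e : rel T) (x : T) : nat :=
  #|[set y | e x y]|.

Definition indegree (T : finType) (e : rel T) (x : T) : nat :=
  #|[set y | e y x]|.

(* A degree is at most #|T|, so the default value #|T| does not affect the
   minimum when T is nonempty. *)
Definition min_outdegree (T : finType) (e : rel T) : nat :=
  \big[minn/#|T|]_(x : T) outdegree e x.

Definition min_indegree (T : finType) (e : rel T) : nat :=
  \big[minn/#|T|]_(x : T) indegree e x.

Definition min_semidegree (T : finType) (e : rel T) : nat :=
  minn (min_outdegree e) (min_indegree e).

Definition has_directed_cycle (T : finType) (e : rel T) (l : nat) : Prop :=
  exists c : seq T, [/\ 0 < l, size c = l & ucycle e c].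

(* Main.v *)
Require Import Defs.
From mathcomp Require Import all_boot all_order all_algebra reals.
From mathcomp Require Import zify ring.
Import Order.TTheory GRing.Theory Num.Theory.

(** Every [p < k] divides [l], and this yields closed walks of length [l] in any
    digraph whose outdegrees exceed [1/k] of its order.  Choose a nonempty
    vertex set [A] and [D] such that all outdegrees inside [A] are at least [D]
    and [k * D - #|A|] is maximal.  By maximality the out-balls in [A] grow
    fast, so that from every vertex of [A] more than half of [A] is reached
    within [k] steps; by averaging, some [w] in [A] is reached from all of [A]
    within [2 * k] steps.
    Let [p] be the gcd of the lengths, at most [3 * k], of closed walks at [w].
    If [p >= k], the outneighbourhoods in [A] of the first [k] vertices of a
    walk from [w] are disjoint, which contradicts [#|A| < k * D].  Hence [p]
    divides [l], and [l >= (3 * k) ^ 2] is a sum of such lengths.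

    In a large oriented graph, by Chebyshev's inequality, a positive proportion
    of the samples of a bounded number [m] of vertices inherit the degree
    condition on most of their vertices, and so contain a closed walk of length
    [l].  A fixed walk pattern thus occurs in a positive proportion of the
    [m]-tuples, and Erdős' theorem on [m]-partite hypergraphs gives a blow-up of
    the pattern, in which the closed walk becomes an [l]-cycle. *)

(** * Numerical semigroups *)

Lemma sumn_flatten_nseq n (q : seq nat) :
  sumn (flatten (nseq n q)) = n * sumn q.
Proof. by elim: n => // n IH; rewrite /= sumn_cat IH mulSn. Qed.

Lemma all_flatten_nseq n (a : pred nat) (q : seq nat) :
  all a q -> all a (flatten (nseq n q)).
Proof. by move=> aq; elim: n => // n IH; rewrite /= all_cat aq. Qed.

(** Bézout's identity with nonnegative coefficients: modulo [a], the negative coefficient [- kn] may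
    be replaced by [kn * (a - 1)]. *)
Lemma gcd_seq_sum_mod (a : nat) (g : seq nat) : 0 < a ->
  exists2 q, all (mem g) q & sumn q = foldr gcdn 0 g %[mod a].
Proof.
move=> a0; elim: g => [|s g [q gq eq_q]]; first by exists [::].
have gq' : all (mem (s :: g)) q.
  by apply: sub_all gq => x /= xg; rewrite inE xg orbT.
have [->|s0] := posnP s.
  exists q; last by rewrite /= gcd0n.
  by apply: sub_all gq => x /= xg; rewrite inE xg orbT.
rewrite /=; set d := foldr gcdn 0 g in eq_q *.
case: (egcdnP d s0) => km kn E _.
exists (nseq km s ++ flatten (nseq (kn * a.-1) q)).
  rewrite all_cat all_flatten_nseq // andbT.
  by apply/allP => x /nseqP[-> _]; rewrite /= inE eqxx.
rewrite sumn_cat sumn_nseq sumn_flatten_nseq -modnDmr -modnMmr eq_q.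
rewrite modnMmr modnDmr mulnC E addnAC.
have -> : kn * d + kn * a.-1 * d = kn * d * a by case: a a0 {eq_q} => //= b _; nia.
by rewrite modnMDl.
Qed.

(* Two equal partial sums modulo [a] delimit a block that can be deleted. *)
Lemma shorten_sum_mod (a : nat) (P : pred nat) (q : seq nat) :
    0 < a -> all P q ->
  exists q', [/\ all P q', sumn q' = sumn q %[mod a] & size q' < a].
Proof.
move=> a0; have [n] := ubnP (size q); elim: n q => // n IH q qn Pq.
have [lt_qa|le_aq] := ltnP (size q) a; first by exists q.
pose f (i : 'I_a.+1) := Ordinal (ltn_pmod (sumn (take i q)) a0).
have /injectivePn[i [j ne_ij fij]] : ~~ injectiveb f.
  by apply/negP => /injectiveP/leq_card; rewrite !card_ord ltnn.
wlog lt_ij : i j ne_ij fij / i < j => [wl|].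
  have := ne_ij; rewrite -val_eqE /= neq_ltn => /orP[|] lt; first exact: (wl i j).
  by apply: (wl j i) => //; rewrite eq_sym.
have jq : j <= size q by apply: leq_trans le_aq; rewrite -ltnS.
have iq : i <= size q by apply: leq_trans jq; apply: ltnW.
have Pq' : all P (take i q ++ drop j q).
  rewrite all_cat; apply/andP; split; apply/allP => x.
    by move=> /mem_take; apply: (allP Pq).
  by move=> /mem_drop; apply: (allP Pq).
have szq' : size (take i q ++ drop j q) < n.
  by rewrite size_cat size_takel // size_drop; lia.
have [q' [Pq'' eq_q' q'a]] := IH _ szq' Pq'.
exists q'; split=> //; rewrite eq_q' -[in RHS](cat_take_drop j q) !sumn_cat.
have /(congr1 val)/= E := fij.
by rewrite -modnDml E modnDml.
Qed.

Lemma sumn_bounded (M : nat) (q : seq nat) :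
  all (fun x => x <= M) q -> sumn q <= size q * M.
Proof.
by elim: q => //= x q IH /andP[xM /IH]; rewrite mulSn; apply: leq_add.
Qed.

(** Modulo a positive generator [a], [l] is a sum of fewer than [a] generators. That sum is at most
    [M ^ 2], hence at most [l], and copies of [a] make up the difference. *)
Lemma numerical_semigroup (g : seq nat) (M l : nat) :
    has (fun s => 0 < s) g -> all (fun s => s <= M) g ->
    foldr gcdn 0 g %| l -> M ^ 2 <= l ->
  exists2 q, all (mem g) q & sumn q = l.
Proof.
move=> /hasP[a ag a0] gM /dvdnP[r lE] Ml.
have [q0 gq0 eq0] := gcd_seq_sum_mod a g a0.
have [q [gq eq szq]] := shorten_sum_mod a _ _ a0 (all_flatten_nseq r _ _ gq0).
have aM : a <= M by apply: (allP gM).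
have qM : sumn q <= l.
  apply: leq_trans Ml; apply: leq_trans (leq_mul (leq_trans (ltnW szq) aM) (leqnn M)).
  by apply: sumn_bounded; apply: sub_all gq => s; apply: (allP gM).
have [r' lE'] : exists r', l = r' * a + sumn q.
  have /dvdnP[r' E] : a %| l - sumn q.
    by rewrite -eqn_mod_dvd // lE eq sumn_flatten_nseq -(modnMmr r (sumn q0)) eq0 modnMmr.
  by exists r'; rewrite -E subnK.
exists (nseq r' a ++ q); last by rewrite sumn_cat sumn_nseq lE' mulnC.
by rewrite all_cat gq andbT; apply/allP => x /nseqP[-> _].
Qed.

(** * Closed walks *)

Fixpoint walk (T : finType) (e : rel T) (n : nat) : rel T :=
  if n is m.+1 then fun x y => [exists z, e x z && walk T e m z y]
  else fun x y => x == y.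
Arguments walk {T} e n.

Lemma walk_cat (T : finType) (e : rel T) m n x y z :
  walk e m x y -> walk e n y z -> walk e (m + n) x z.
Proof.
elim: m x => [|m IH] x /=; first by move=> /eqP->.
move=> /existsP[w /andP[xw wy]] yz; apply/existsP; exists w.
by rewrite xw IH.
Qed.

Lemma walk1 (T : finType) (e : rel T) x y : e x y -> walk e 1 x y.
Proof. by move=> xy; apply/existsP; exists y; rewrite xy /=. Qed.

Lemma walk_path (T : finType) (e : rel T) n x y :
  walk e n x y -> exists p, [/\ path e x p, last x p = y & size p = n].
Proof.
elim: n x => [|n IH] x /=; first by move=> /eqP->; exists [::].
move=> /existsP[z /andP[xz /IH[p [pp lp sp]]]].
by exists (z :: p); rewrite /= xz pp lp sp.
Qed.

Lemma walk_sumn (T : finType) (e : rel T) x (q : seq nat) :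
  all (fun s => walk e s x x) q -> walk e (sumn q) x x.
Proof.
elim: q => /= [|s q IH]; first by rewrite eqxx.
by move=> /andP[xs /IH]; apply: walk_cat.
Qed.

(** * Out-balls inside a vertex set *)

Definition outdegree_in (T : finType) (e : rel T) (A : {set T}) (x : T) : nat :=
  #|[set y in A | e x y]|.
Arguments outdegree_in {T}.

Fixpoint ball (T : finType) (e : rel T) (A : {set T}) (u : T) (t : nat) : {set T} :=
  if t is s.+1 then
    ball T e A u s :|: [set y in A | [exists x in ball T e A u s, e x y]]
  else [set u].
Arguments ball {T}.

Lemma ball_sub (T : finType) (e : rel T) (A : {set T}) u t :
  u \in A -> ball e A u t \subset A.
Proof.
move=> uA; elim: t => [|t IH] /=; first by rewrite sub1set.
by rewrite subUset IH; apply/subsetP => y; rewrite inE => /andP[].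
Qed.

Lemma ball_self (T : finType) (e : rel T) (A : {set T}) u t : u \in ball e A u t.
Proof. by elim: t => [|t IH] /=; rewrite !inE ?IH. Qed.

Lemma ball_walk (T : finType) (e : rel T) (A : {set T}) u t y :
  y \in ball e A u t -> exists2 n, n <= t & walk e n u y.
Proof.
elim: t y => [|t IH] y /=; first by rewrite inE => /eqP->; exists 0 => /=.
rewrite !inE => /orP[/IH[n nt w]|/andP[_ /existsP[x /andP[/IH[n nt w] xy]]]].
  by exists n => //; apply: leqW.
by exists (n + 1); [rewrite addn1 ltnS | apply: walk_cat w (walk1 _ _ _ _ xy)].
Qed.

(* The last clause states, without subtraction, that [k * D - #|A|] is maximal. *)
Lemma extremal_subset (T : finType) (e : rel T) (k : nat) (B : {set T}) :
    B != set0 -> (forall x, x \in B -> #|B| < k * outdegree_in e B x) ->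
  exists A D, [/\ A != set0, #|A| < k * D,
    forall x, x \in A -> D <= outdegree_in e A x &
    forall (X : {set T}) D', X != set0 ->
      (forall x, x \in X -> D' <= outdegree_in e X x) ->
      k * D' + #|A| <= k * D + #|X|].
Proof.
move=> B0 degB.
have degT (X : {set T}) x : outdegree_in e X x < #|T|.+1 by rewrite ltnS max_card.
pose P (z : {set T} * 'I_#|T|.+1) :=
  (z.1 != set0) && [forall x in z.1, z.2 <= outdegree_in e z.1 x].
(* The objective [k * D - #|A|] is shifted by [#|T|], so that the subtraction in [nat] never
   truncates. *)
pose f (z : {set T} * 'I_#|T|.+1) := k * z.2 + (#|T| - #|z.1|).
have [b0 b0B] := set0Pn _ B0.
have [b bB bmin] := arg_minnP (outdegree_in e B) b0B.
pose z0 := (B, Ordinal (degT B b)).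
have Pz0 : P z0 by rewrite /P B0; apply/forall_inP.
have [[A D] /andP[/= A0 /forall_inP/= degA] maxA] := arg_maxnP f Pz0.
have cT (X : {set T}) : #|X| <= #|T| by apply: max_card.
exists A, D; split=> //.
  have arith t a c x y : a <= t -> c <= t -> c < x -> x + (t - c) <= y + (t - a) ->
    a < y by lia.
  exact: arith (cT A) (cT B) (degB _ bB) (maxA _ Pz0).
move=> X D' X0 degX.
have [x0 x0X] := set0Pn _ X0.
have D'T : D' < #|T|.+1 by apply: leq_trans (degT X x0); rewrite ltnS degX.
have PX : P (X, Ordinal D'T) by rewrite /P X0; apply/forall_inP.
have arith t a c x y : a <= t -> c <= t -> x + (t - c) <= y + (t - a) ->
  x + a <= y + c by lia.
exact: arith (cT A) (cT X) (maxA _ PX).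
Qed.

(** If only [g <= D] new vertices enter the ball, its vertices keep at least [D - g] outneighbours
    inside it, and maximality of [A] forces [k * g] to be at least the number of vertices of [A]
    outside the ball. So while the ball fills at most half of [A], each step adds at least
    [#|A| / (2 * k)] vertices. *)
Lemma half_reached (T : finType) (e : rel T) (k D : nat) (A : {set T}) (u : T) :
    #|A| < k * D -> (forall x, x \in A -> D <= outdegree_in e A x) ->
    (forall (X : {set T}) D', X != set0 ->
      (forall x, x \in X -> D' <= outdegree_in e X x) ->
      k * D' + #|A| <= k * D + #|X|) ->
    u \in A -> #|A| < 2 * #|ball e A u k|.
Proof.
move=> AD degA maxA uA.
pose b t := #|ball e A u t|.
have sub_b t : ball e A u t \subset ball e A u t.+1 by apply: subsetUl.
have growth t : #|A| <= b t + k * (b t.+1 - b t).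
  set g := b t.+1 - b t.
  have [gD|Dg] := leqP g D; last first.
    apply: leq_trans (leq_addl _ _); apply: leq_trans (ltnW AD) _.
    by rewrite leq_mul2l (ltnW Dg) orbT.
  have gE : g = #|ball e A u t.+1 :\: ball e A u t|.
    by rewrite cardsD (setIidPr (sub_b t)).
  have := maxA (ball e A u t) (D - g).
  have -> : ball e A u t != set0 by apply/set0Pn; exists u; apply: ball_self.
  move=> /(_ isT); rewrite -/(b t) mulnBr.
  have : k * g <= k * D by rewrite leq_mul2l gD orbT.
  move=> hk H; suff: k * D - k * g + #|A| <= k * D + b t by lia.
  apply: H => x xt; rewrite leq_subLR.
  have xA : x \in A by apply: (subsetP (ball_sub _ e A u t uA)).
  apply: leq_trans (degA x xA) _; rewrite gE /outdegree_in.
  rewrite addnC; apply: leq_trans (leq_card_setU _ _); apply: subset_leq_card.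
  apply/subsetP => y; rewrite !inE => /andP[yA xy].
  case: (y \in ball e A u t) => //=; first by rewrite xy.
  by rewrite ?orbF yA /=; apply/existsP; exists x; rewrite xt xy.
have k0 : 0 < k by case: (k) AD.
rewrite ltnNge; apply/negP => small.
have b_mono s t : s <= t -> b s <= b t.
  elim: t => [|t IH]; first by rewrite leqn0 => /eqP->.
  rewrite leq_eqVlt => /orP[/eqP->//|]; rewrite ltnS => /IH H.
  by apply: leq_trans H _; apply: subset_leq_card.
(* The term [2 * k] accounts for the starting vertex [u] and makes the bound at [t = k] exceed one
   half strictly. *)
have linear t : t <= k -> t * #|A| + 2 * k <= 2 * (k * b t).
  elim: t => [_|t IH tk]; first by rewrite /b /= cards1 muln1.
  have bt := b_mono _ _ (leqnSn t); have btk := b_mono _ _ (ltnW tk).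
  have kb : k * b t <= k * b t.+1 by rewrite leq_mul2l bt orbT.
  have := IH (ltnW tk); have := growth t; move: small; rewrite -/(b k) mulnBr mulSn.
  by lia.
have := linear k (leqnn k); rewrite mulnCA [2 * k]mulnC -mulnDr leq_pmul2l //.
by move: small; rewrite -/(b k); lia.
Qed.

(** Double counting the pairs [(u, w)] with [w] in the ball of [u] yields a [w] reached within [k]
    steps from more than half of [A]. The ball of any [u] is also more than half of [A], so it meets
    this set. *)
Lemma common_sink (T : finType) (e : rel T) (k : nat) (A : {set T}) :
    A != set0 -> (forall u, u \in A -> #|A| < 2 * #|ball e A u k|) ->
  exists2 w, w \in A &
    forall u, u \in A -> exists2 n, n <= 2 * k & walk e n u w.
Proof.
move=> A0 half; pose inb w := [set u in A | w \in ball e A u k].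
have cA : 0 < #|A| by rewrite card_gt0.
have /exists_inP[w wA big] : [exists w in A, #|A| < 2 * #|inb w|].
  apply: contraT => /exists_inPn small.
  have : \sum_(u in A) 2 * #|ball e A u k| <= #|A| * #|A|.
    have -> : \sum_(u in A) 2 * #|ball e A u k| = \sum_(w in A) 2 * #|inb w|.
      rewrite -!big_distrr /=; congr (2 * _).
      transitivity (\sum_(u in A) \sum_(w in A) (w \in ball e A u k)).
        apply: eq_bigr => u uA; rewrite -sum1_card big_mkcond /=.
        rewrite (bigID (mem A)) /= [X in _ + X]big1 ?addn0; last first.
          move=> w wA; case: ifP => // /(subsetP (ball_sub _ e A u k uA)).
          by rewrite (negPf wA).
        by apply: eq_bigr => w _; case: (w \in _).
      rewrite exchange_big; apply: eq_bigr => w _ /=.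
      rewrite -sum1_card /inb [RHS]big_mkcond [LHS]big_mkcond /=.
      by apply: eq_bigr => u _; rewrite inE; case: (u \in A); case: (w \in _).
    rewrite -sum_nat_const; apply: leq_sum => w wA.
    by rewrite leqNgt small.
  rewrite leqNgt; suff -> : #|A| * #|A| < \sum_(u in A) 2 * #|ball e A u k| by [].
  apply: (@leq_trans (#|A| * #|A|.+1)).
    by rewrite ltn_pmul2l.
  by rewrite -sum_nat_const; apply: leq_sum => u uA; apply: half.
exists w => // u uA.
have /set0Pn[y] : ball e A u k :&: inb w != set0.
  rewrite -card_gt0; have := cardsUI (ball e A u k) (inb w).
  have : #|ball e A u k :|: inb w| <= #|A|.
    apply: subset_leq_card; rewrite subUset ball_sub //=.
    by apply/subsetP => y; rewrite inE => /andP[].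
  by have := half u uA; lia.
rewrite !inE => /and3P[/ball_walk[m mk uy] _ /ball_walk[n nk yw]].
by exists (m + n); [lia | apply: walk_cat uy yw].
Qed.

Lemma closed_walk (T : finType) (e : rel T) (k l : nat) (B : {set T}) :
    B != set0 -> (forall x, x \in B -> #|B| < k * outdegree_in e B x) ->
    (forall p, 0 < p -> p < k -> p %| l) -> (3 * k) ^ 2 <= l ->
  exists x, walk e l x x.
Proof.
move=> B0 degB divl hl.
have [A [D [A0 AD degA maxA]]] := extremal_subset _ e k B B0 degB.
have [w wA sink] := common_sink _ e k A A0
  (fun u uA => half_reached _ e k D A u AD degA maxA uA).
have k0 : 0 < k by case: (k) AD.
have D0 : 0 < D by move: AD; case: (D) => //; rewrite muln0.
(* The bound [3 * k] covers at most [k - 1] steps along the walk [u] below, one step to an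
   outneighbour, and at most [2 * k] steps back to [w]. *)
pose g := [seq s <- iota 0 (3 * k).+1 | walk e s w w].
have memg s : s <= 3 * k -> walk e s w w -> s \in g.
  by move=> sk sw; rewrite mem_filter sw mem_iota add0n ltnS.
pose p := foldr gcdn 0 g.
have pg s : s \in g -> p %| s.
  rewrite /p; elim: (g) => //= a r IH; rewrite inE => /orP[/eqP->|/IH].
    exact: dvdn_gcdl.
  by apply: dvdn_trans; apply: dvdn_gcdr.
(* The default [x] never occurs on [A], where [0 < D] provides an outneighbour. *)
pose nxt x := odflt x [pick y in A | e x y].
have nxtP x : x \in A -> (nxt x \in A) && e x (nxt x).
  move=> xA; rewrite /nxt; case: pickP => //= none.
  have := leq_trans D0 (degA x xA).
  by rewrite card_gt0 => /set0Pn[y]; rewrite inE none.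
pose u i := iter i nxt w.
have uA i : u i \in A by elim: i => //= i /nxtP/andP[].
have uw i : walk e i w (u i).
  elim: i => [|i IH]; first by rewrite /= eqxx.
  have /andP[_ step] := nxtP _ (uA i).
  by rewrite -[X in walk e X]addn1; apply: walk_cat IH (walk1 _ _ _ _ step).
have ret i x : x \in A -> e (u i) x ->
    exists2 r, r <= 2 * k & walk e (i + 1 + r) w w.
  move=> xA ux; have [r rk xw] := sink x xA; exists r => //.
  by apply: walk_cat xw; apply: walk_cat (uw i) (walk1 _ _ _ _ ux).
have pos : has (fun s => 0 < s) g.
  have /andP[nA en] := nxtP _ wA; have [r rk rw] := ret 0 _ nA en.
  by apply/hasP; exists (0 + 1 + r); [apply: memg => //; lia | lia].
have p0 : 0 < p.
  have /hasP[s sg s0] := pos; have := pg _ sg; case: (p) => //.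
  by rewrite dvd0n => /eqP s00; rewrite s00 in s0.
have pk : p < k.
  rewrite ltnNge; apply/negP => kp.
  (* Returning from a common outneighbour [x] by one and the same walk makes [i + 1 + r] and
     [j + 1 + r] multiples of [p]; since [i] and [j] are below [k <= p], they coincide. *)
  have disj (i j : 'I_k) x : x \in A -> e (u i) x -> e (u j) x -> i = j.
    move=> xA ix jx; have [r rk xw] := sink x xA.
    have dv (h : 'I_k) : e (u h) x -> p %| h + (1 + r).
      move=> hx; apply: pg; rewrite addnA; apply: memg.
        by have := ltn_ord h; lia.
      by apply: walk_cat xw; apply: walk_cat (uw h) (walk1 _ _ _ _ hx).
    have : (i + (1 + r) == j + (1 + r) %[mod p]).
      by rewrite (eqP (dv _ ix)) (eqP (dv _ jx)).
    rewrite eqn_modDr !modn_small => [/eqP/val_inj//||].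
      by apply: leq_trans kp.
    by apply: leq_trans kp.
  have : \sum_(i < k) outdegree_in e A (u i) <= #|A|.
    rewrite -[X in _ <= X]sum1_card.
    apply: (@leq_trans (\sum_(i < k) \sum_(x in A) (e (u i) x))).
      apply: leq_sum => i _; rewrite /outdegree_in -sum1_card big_mkcond.
      rewrite [X in _ <= X]big_mkcond; apply: leq_sum => x _; rewrite inE.
      by case: (x \in A); case: (e _ _).
    rewrite exchange_big /=; apply: leq_sum => x xA.
    have [/existsP[i ix]|none] := boolP [exists i : 'I_k, e (u i) x].
      rewrite (bigD1 i) //= big1 ?addn0 ?ix // => j /eqP ji.
      by case jx: (e _ _) => //; case: ji; apply: disj jx ix.
    rewrite big1 // => j _; case jx: (e _ _) => //.
    by case/negP: none; apply/existsP; exists j.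
  apply/negP; rewrite -ltnNge; apply: leq_trans AD _.
  have -> : k * D = \sum_(i < k) D by rewrite sum_nat_const card_ord.
  by apply: leq_sum => i _; apply: degA.
have gM : all (fun s => s <= 3 * k) g.
  by apply/allP => s; rewrite mem_filter mem_iota => /and3P[_ _]; rewrite add0n ltnS.
have [q gq <-] := numerical_semigroup g _ l pos gM (divl _ p0 pk) hl.
exists w; apply: walk_sumn; apply: sub_all gq => s.
by rewrite /= mem_filter => /andP[].
Qed.

(** * Blow-ups *)

Definition upd (I V : finType) (x : {ffun I -> V}) (j : I) (v : V) : {ffun I -> V} :=
  [ffun i => if i == j then v else x i].
Arguments upd {I V}.

(** Swapping [v] with the coordinate [x j] is an involution on the pairs [(x, v)]. In counting
    terms, resampling one coordinate preserves averages. *)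
Lemma big_upd (R : Type) (idx : R) (op : Monoid.com_law idx)
    (I V : finType) (j : I) (F : {ffun I -> V} -> R) :
  \big[op/idx]_x \big[op/idx]_v F (upd x j v) =
  \big[op/idx]_x \big[op/idx]_(v : V) F x.
Proof.
rewrite !pair_bigA /=.
pose h (z : {ffun I -> V} * V) := (upd z.1 j z.2, z.1 j).
have hK : involutive h.
  move=> [x v]; rewrite /h /=; congr (_, _); last by rewrite ffunE eqxx.
  by apply/ffunP => i; rewrite !ffunE; case: eqP => // ->.
by rewrite [RHS](reindex_inj (inv_inj hK)).
Qed.

(** Falling factorials are compared factor by factor: for [i < s], [4 * M * (f - i)] is at least
    [2 * n - n]. *)
Lemma bin_dense (n f s M : nat) :
  n <= 2 * M * f -> 4 * M * s <= n -> 'C(n, s) <= (4 * M) ^ s * 'C(f, s).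
Proof.
move=> nf sn; rewrite -(leq_pmul2r (fact_gt0 s)) -mulnA !bin_ffact !ffact_prod.
have -> : (4 * M) ^ s = \prod_(i < s) (4 * M) by rewrite prod_nat_const card_ord.
rewrite -big_split /=; apply: leq_prod => i _.
have : 4 * M * i <= 4 * M * s by rewrite leq_mul2l (ltnW (ltn_ord i)) orbT.
by rewrite mulnBr; lia.
Qed.

Lemma sum_le_threshold (T : finType) (f : T -> nat) (a b : nat) :
  (forall x, f x <= b) ->
  \sum_x f x <= a * #|T| + b * #|[set x | a <= f x]|.
Proof.
move=> fb; rewrite (bigID [pred x | a <= f x]) /= addnC; apply: leq_add.
  rewrite mulnC -sum_nat_const [X in _ <= X](bigID [pred x | a <= f x]) /=.
  apply: leq_trans (leq_addl _ _); rewrite big_mkcond [X in _ <= X]big_mkcond.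
  by apply: leq_sum => x _ /=; have [|/ltnW] := leqP a (f x).
rewrite mulnC -sum_nat_const big_mkcond [X in _ <= X]big_mkcond.
by apply: leq_sum => x _ /=; rewrite inE; case: ifP.
Qed.

(** One coordinate of Erdős' argument. By averaging, at least a [1 / (2 * M)] fraction of the points
    [x] have at least [n / (2 * M)] good values at [j], hence a [(4 * M) ^ s] -th part of all
    [s]-sets consists of good values for [x]. Averaging over the [s]-sets then gives one [X] that
    suits many [x]. *)
Lemma blowup_step (I V : finType) (Q : {set {ffun I -> V}}) (j : I) (s M : nat) :
    0 < M -> 0 < s -> 4 * M * s <= #|V| -> #|V| ^ #|I| <= M * #|Q| ->
  exists2 X : {set V}, #|X| = s &
    #|V| ^ #|I| <=
      2 * M * (4 * M) ^ s * #|[set x | [forall v in X, upd x j v \in Q]]|.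
Proof.
move=> M0 s0 sV dQ; set n := #|V| in sV dQ *.
set N := n ^ #|I| in dQ *.
have NE : #|{ffun I -> V}| = N by rewrite card_ffun.
have sn : s <= n by nia.
have n0 : 0 < n by apply: leq_trans sn.
pose good x := [set v | upd x j v \in Q].
pose big := [set x | n <= 2 * M * #|good x|].
have sum_good : \sum_x #|good x| = n * #|Q|.
  transitivity (\sum_x \sum_v (upd x j v \in Q)).
    apply: eq_bigr => x _; rewrite -sum1_card big_mkcond.
    by apply: eq_bigr => v _; rewrite inE; case: (_ \in _).
  rewrite (big_upd _ _ _ _ _ j (fun x => (x \in Q) : nat)) -sum1_card big_distrr /= [RHS]big_mkcond.
  apply: eq_bigr => x _; rewrite sum_nat_const; case: (x \in Q); rewrite /= ?muln0 //.
have Nbig : N <= 2 * M * #|big|.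
  have H := sum_le_threshold _ (fun x => 2 * M * #|good x|) n (2 * M * n).
  rewrite -(leq_pmul2l n0); have := H (fun x => _); rewrite -big_distrr /= sum_good NE.
  have gn x : 2 * M * #|good x| <= 2 * M * n by rewrite leq_mul2l max_card orbT.
  move=> /(_ gn); rewrite -/big.
  have : n * N <= n * (M * #|Q|) by rewrite leq_mul2l dQ orbT.
  by nia.
pose ext (X : {set V}) := [set x | [forall v in X, upd x j v \in Q]].
have extE x (X : {set V}) : (x \in ext X) = (X \subset good x).
  rewrite inE; apply/forall_inP/subsetP => H v /H; by rewrite inE.
have count : 'C(n, s) * #|big| <=
    \sum_(X : {set V} | #|X| == s) (4 * M) ^ s * #|ext X|.
  rewrite -big_distrr /=.
  have -> : \sum_(X : {set V} | #|X| == s) #|ext X| = \sum_x 'C(#|good x|, s).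
    transitivity (\sum_(X : {set V} | #|X| == s) \sum_x (x \in ext X)).
      apply: eq_bigr => X _; rewrite -sum1_card big_mkcond.
      by apply: eq_bigr => x _; case: (_ \in _).
    rewrite exchange_big; apply: eq_bigr => x _ /=.
    rewrite -cards_draws -sum1_card big_mkcond [RHS]big_mkcond /=.
    apply: eq_bigr => X _; rewrite extE inE.
    by case: (#|X| == s); case: (X \subset _).
  rewrite mulnC -sum_nat_const big_distrr [X in _ <= X](bigID (mem big)) /=.
  apply: leq_trans (leq_addr _ _); apply: leq_sum => x; rewrite inE => xb.
  exact: bin_dense.
have /exists_inP[X /eqP sX XB] :
    [exists X : {set V} in [pred X : {set V} | #|X| == s], #|big| <= (4 * M) ^ s * #|ext X|].
  apply: contraT => /exists_inPn small.
  move: count; rewrite leqNgt.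
  suff -> : \sum_(X : {set V} | #|X| == s) (4 * M) ^ s * #|ext X| < 'C(n, s) * #|big| by [].
  have cs : #|[pred X : {set V} | #|X| == s]| = 'C(n, s) by rewrite -card_draws cardsE.
  rewrite -cs -sum_nat_const.
  have : 0 < #|[pred X : {set V} | #|X| == s]| by rewrite cs bin_gt0.
  case/card_gt0P=> X0 X0s.
  rewrite (bigD1 X0) //= [X in _ < X](bigD1 X0) //= -addSn; apply: leq_add.
    by rewrite ltnNge small.
  by apply: leq_sum => X /andP[Xs _]; apply: ltnW; rewrite ltnNge small.
exists X => //; apply: leq_trans Nbig _; rewrite -[X in _ <= X]mulnA.
by rewrite leq_mul2l XB orbT.
Qed.

(** Induction on the coordinates already blown up; those outside [r] remain fixed by [x]. The
    density [1 / M'] survives each step, which allows [blowup_step] to be applied to the set of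
    points obtained so far. *)
Lemma blowup_seq (I : finType) (r : seq I) (s M : nat) :
    uniq r -> 0 < s -> 0 < M ->
  exists n0 M', 0 < M' /\ forall (V : finType) (Q : {set {ffun I -> V}}),
    n0 <= #|V| -> #|V| ^ #|I| <= M * #|Q| ->
    exists2 X : I -> {set V}, forall i, i \in r -> #|X i| = s &
      #|V| ^ #|I| <= M' * #|[set x : {ffun I -> V} | [forall z : {ffun I -> V},
        [forall i, if i \in r then z i \in X i else z i == x i] ==> (z \in Q)]]|.
Proof.
move=> + s0 M0; elim: r => [_|a r IH /= /andP[ar ur]].
  exists 0, M; split=> // V Q _ dQ; exists (fun _ => set0) => //.
  apply: leq_trans dQ _; rewrite leq_mul2l; apply/orP; right.
  apply: subset_leq_card; apply/subsetP => x xQ; rewrite inE.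
  apply/forallP => z; apply/implyP => /forallP zx.
  by have -> : z = x by apply/ffunP => i; apply/eqP; apply: zx.
have [n0 [M1 [M1_0 IH']]] := IH ur.
exists (n0 + 4 * M1 * s), (2 * M1 * (4 * M1) ^ s); split.
  by rewrite !muln_gt0 expn_gt0 !muln_gt0 M1_0.
move=> V Q nV dQ.
have [X Xs dX] := IH' V Q (leq_trans (leq_addr _ _) nV) dQ.
have [Xa sXa dXa] := blowup_step _ _ _ a s M1 M1_0 s0 (leq_trans (leq_addl _ _) nV) dX.
exists (fun i => if i == a then Xa else X i).
  by move=> i; rewrite inE; case: eqP => //= _ /Xs.
apply: leq_trans dXa _; rewrite leq_mul2l; apply/orP; right.
apply: subset_leq_card; apply/subsetP => x; rewrite !inE => /forall_inP H.
apply/forallP => z; apply/implyP => /forallP zX.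
have za : z a \in Xa by have := zX a; rewrite inE eqxx.
(* Outside [r], [z] agrees with [upd x a (z a)], so the property of that point applies to [z]. *)
have := H _ za; rewrite inE => /forallP/(_ z)/implyP; apply.
apply/forallP => i; have := zX i; rewrite inE ffunE.
case: (eqVneq i a) => [->|//] /=; by rewrite (negPf ar).
Qed.

Lemma blowup (I : finType) (s M : nat) : 0 < s -> 0 < M ->
  exists n0, forall (V : finType) (Q : {set {ffun I -> V}}),
    n0 <= #|V| -> #|V| ^ #|I| <= M * #|Q| ->
    exists2 X : I -> {set V}, forall i, #|X i| = s &
      forall z : {ffun I -> V}, (forall i, z i \in X i) -> z \in Q.
Proof.
move=> s0 M0; have [n0 [M' [M'0 H]]] := blowup_seq _ _ s M (enum_uniq I) s0 M0.
(* The successor makes [V] nonempty, so that the lower bound [#|V| ^ #|I|] is positive and some [x]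
   exists. *)
exists n0.+1 => V Q nV dQ; have [X Xs dX] := H V Q (ltnW nV) dQ.
exists X => [i|z zX]; first by rewrite Xs // mem_enum.
have : 0 < M' * #|[set x : {ffun I -> V} | [forall z : {ffun I -> V},
        [forall i, if i \in enum I then z i \in X i else z i == x i] ==> (z \in Q)]]|.
  by apply: leq_trans dX; rewrite expn_gt0 (leq_trans _ nV).
rewrite muln_gt0 M'0 /= card_gt0 => /set0Pn[x]; rewrite inE => /forallP/(_ z)/implyP.
by apply; apply/forallP => i; rewrite mem_enum zX.
Qed.

(** Greedy choice. An index repeated in [c] receives distinct representatives, and this is what
    turns a closed walk into a cycle. *)
Lemma transversal_seq (I V : finType) (c : seq I) (X : I -> {set V}) :
    (forall i, size c <= #|X i|) ->
  exists2 y, uniq y & all2 (fun i v => v \in X i) c y.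
Proof.
elim: c => [|i c IH] Xc; first by exists [::].
have [|y uy cy] := IH; first by move=> j; apply: ltnW (Xc j).
have szy : size y = size c by move: cy; rewrite all2E => /andP[/eqP].
have /subsetPn[v vX vy] : ~~ (X i \subset y).
  apply/negP => /subset_leq_card; rewrite leqNgt.
  by rewrite (leq_ltn_trans (card_size y)) // szy Xc.
by exists (v :: y); rewrite /= ?vy ?vX.
Qed.

Lemma path_all2 (I V : Type) (r : rel I) (e : rel V) (X : I -> pred V) i v c y :
    (forall a b u w, r a b -> X a u -> X b w -> e u w) ->
  X i v -> all2 X c y -> path r i c -> path e v y.
Proof.
move=> rX; elim: c y i v => [|j c IH] [|w y] i v //= Xv /andP[Xw cy] /andP[ij rc].
by rewrite (rX _ _ _ _ ij Xv Xw) /=; apply: IH rc.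
Qed.

Lemma all2_rcons (I V : Type) (P : I -> V -> bool) c y i v :
  all2 P (rcons c i) (rcons y v) = all2 P c y && P i v.
Proof.
elim: c y => [|j c IH] [|w y] /=; rewrite ?andbT ?andbF //.
- by case: y => /=; rewrite ?andbF.
- by case: c {IH} => /=; rewrite ?andbF.
- by rewrite IH andbA.
Qed.

(** If all transversals carry the pattern, then consecutive classes of [c] are completely joined,
    and any choice of distinct representatives along [c] is a cycle. *)
Lemma blowup_cycle (I V : finType) (e : rel V) (c : seq I) (X : I -> {set V}) :
    irreflexive e -> 0 < size c -> (forall i, size c <= #|X i|) ->
    (forall z : {ffun I -> V}, (forall i, z i \in X i) -> cycle e (map z c)) ->
  exists2 y, size y = size c & ucycle e y.
Proof.
move=> irr c0 Xc cyc; pose r a b := [forall u in X a, forall w in X b, e u w].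
have Xne i : exists v, v \in X i.
  by apply/set0Pn; rewrite -card_gt0; apply: leq_trans (Xc i).
have rP a b : (forall z : {ffun I -> V}, (forall i, z i \in X i) -> e (z a) (z b)) -> r a b.
  move=> H; apply/forall_inP => u uX; apply/forall_inP => w wX.
  pose z0 := [ffun i => xchoose (Xne i)].
  have z0X i : z0 i \in X i by rewrite ffunE; apply: xchooseP.
  (* Equal consecutive indices would produce a loop; distinct ones can be assigned [u] and [w]
     independently. *)
  have [eqab|ne] := eqVneq a b.
    by have := H z0 z0X; rewrite eqab irr.
  have := H (upd (upd z0 a u) b w); rewrite !ffunE eqxx (negPf ne) eqxx; apply.
  move=> i; have := z0X i; rewrite !ffunE => z0Xi.
  by have [->|_] := eqVneq i b; last have [->|_] := eqVneq i a.
have path_r x p : (forall z : {ffun I -> V}, (forall i, z i \in X i) ->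
    path e (z x) (map z p)) -> path r x p.
  elim: p x => //= a p IH x H.
  by rewrite rP ?IH // => z /H/andP[].
have cr : cycle r c.
  case: c c0 Xc cyc => //= a p _ _ cyc.
  by apply: path_r => z /cyc; rewrite map_rcons.
have [y uy cy] := transversal_seq _ _ c X Xc.
have szy : size y = size c by move: cy; rewrite all2E => /andP[/eqP].
exists y => //; rewrite /ucycle uy andbT.
case: c y cy cr {uy szy c0 Xc cyc} => [|i c] [|v y] //= /andP[vX cy] cr.
apply: (path_all2 _ _ r e (fun i v => v \in X i)) cr => //.
  by move=> a b u w /forall_inP/(_ u) H uX wX; apply: (forall_inP (H uX)).
by rewrite all2_rcons cy.
Qed.

Lemma walk_cycle (T : finType) (e : rel T) l x :
  0 < l -> walk e l x x -> exists2 c, size c = l & cycle e c.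
Proof.
move=> l0 /walk_path[p [pp lp sp]].
case/lastP: p pp lp sp => [|p y] pp lp sp; first by rewrite -sp in l0.
move: lp sp pp; rewrite last_rcons size_rcons => -> sp pp.
by exists (x :: p); rewrite //= sp.
Qed.

(** * Sampling *)

Local Open Scope ring_scope.

Lemma sum_bool_card (T : finType) (P : pred T) :
  (\sum_x (P x : nat))%N = #|[set x | P x]|.
Proof.
rewrite -sum1_card [RHS]big_mkcond; apply: eq_bigr => x _.
by rewrite inE; case: (P x).
Qed.

(* The deviation of an edge indicator from its mean, scaled by [#|V|] to stay in
   the integers. *)
Definition edge_dev (V : finType) (e : rel V) (v w : V) : int :=
  #|V|%:Z * (e v w)%:Z - (outdegree e v)%:Z.
Arguments edge_dev {V}.

Lemma sum_edge_dev (V : finType) (e : rel V) v : \sum_w edge_dev e v w = 0.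
Proof.
rewrite sumrB sumr_const -mulr_sumr -(big_morph Posz PoszD (erefl _)).
by rewrite sum_bool_card -mulr_natl natz; apply: subrr.
Qed.

Lemma edge_dev_sq (V : finType) (e : rel V) v w :
  edge_dev e v w ^+ 2 <= (#|V| ^ 2)%N%:Z.
Proof.
have : (outdegree e v <= #|V|)%N by apply: max_card.
rewrite /edge_dev; case: (e v w); move: (outdegree _ _) #|V| => d n; nia.
Qed.

(** The deviations are orthogonal: with [x i] and [x j] fixed, the sum over the values of another
    coordinate [x h] vanishes. Only the squares remain, at most [#|I|] of them, each bounded by
    [#|V| ^ 2]. *)
Lemma second_moment (I V : finType) (e : rel V) (i : I) :
  \sum_(x : {ffun I -> V}) (\sum_(j | j != i) edge_dev e (x i) (x j)) ^+ 2
    <= (#|I| * #|V| ^ 2 * #|V| ^ #|I|)%N%:Z.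
Proof.
have [V0|V0] := posnP #|V|.
  rewrite big1 // => x _; by have := card0_eq V0 (x i).
under eq_bigr do rewrite expr2 big_distrlr /=.
rewrite exchange_big /=.
have cross j h : j != i -> h != i -> h != j ->
    \sum_(x : {ffun I -> V}) edge_dev e (x i) (x j) * edge_dev e (x i) (x h) = 0.
  move=> ji hi hj; pose F (x : {ffun I -> V}) := edge_dev e (x i) (x j) * edge_dev e (x i) (x h).
  have : \sum_x \sum_v F (upd x h v) = \sum_x \sum_(v : V) F x by apply: big_upd.
  rewrite [LHS]big1 => [|x _]; last first.
    under eq_bigr => v _ do
      rewrite /F !ffunE eqxx [i == h]eq_sym [j == h]eq_sym (negPf hi) (negPf hj).
    by rewrite -mulr_sumr sum_edge_dev mulr0.
  under eq_bigr do rewrite sumr_const.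
  rewrite sumrMnl => /esym/eqP; rewrite mulrn_eq0 -[#|_| == _]negbK -lt0n V0 /=.
  by move/eqP.
rewrite (eq_bigr (fun j => \sum_(x : {ffun I -> V}) edge_dev e (x i) (x j) ^+ 2)); last first.
  move=> j ji; rewrite exchange_big (bigD1 j) //= [X in _ + X]big1 ?addr0 //.
  by move=> h /andP[hi hj]; apply: cross.
have bound j : \sum_(x : {ffun I -> V}) edge_dev e (x i) (x j) ^+ 2 <=
    (#|V| ^ 2 * #|V| ^ #|I|)%N%:Z.
  apply: (@le_trans _ _ (\sum_(x : {ffun I -> V}) (#|V| ^ 2)%N%:Z)).
    by apply: ler_sum => x _; apply: edge_dev_sq.
  by rewrite sumr_const card_ffun -mulr_natl natz -PoszM mulnC.
apply: (@le_trans _ _ (\sum_(j : I) (#|V| ^ 2 * #|V| ^ #|I|)%N%:Z)).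
  rewrite big_mkcond; apply: ler_sum => j _; case: ifP => // _.
by rewrite sumr_const -mulr_natl natz -PoszM mulnA.
Qed.

(** Vertices are sampled with repetition, so the sample is a digraph on the index set [I], pulled
    back along [x]. *)
Definition sample_outdegree (I V : finType) (e : rel V) (x : {ffun I -> V}) (i : I) : nat :=
  outdegree (relpre x e) i.
Arguments sample_outdegree {I V}.

(* The sampled outdegree is below [(1 + 1 / (2 * N)) * #|I| / k], whereas its
   expectation is about [(1 + 1 / N) * #|I| / k]. *)
Definition poor (I V : finType) (e : rel V) (N k : nat) (x : {ffun I -> V}) (i : I) : bool :=
  (2 * (N * k) * sample_outdegree e x i < (2 * N + 1) * #|I|)%N.
Arguments poor {I V}.

Lemma sum_edge_dev_sample (I V : finType) (e : rel V) (x : {ffun I -> V}) (i : I) :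
    irreflexive e ->
  \sum_(j | j != i) edge_dev e (x i) (x j) =
    #|V|%:Z * (sample_outdegree e x i)%:Z - (#|I|.-1)%:Z * (outdegree e (x i))%:Z.
Proof.
move=> irr; rewrite sumrB -mulr_sumr sumr_const -mulr_natl natz; congr (_ * _ - _ * _).
  rewrite -(big_morph Posz PoszD (erefl _)) /sample_outdegree /outdegree -sum_bool_card.
  by rewrite [in RHS](bigD1 i) //= irr.
by congr Posz; rewrite -(cardC1 i).
Qed.

(** Write [m], [n] for the orders of [I], [V] and [a] for [N * k]. The poverty threshold lies
    [m * n / (2 * a)] below the scaled lower bound for the mean; omitting [j = i] costs at most half
    of this gap, as [4 * N + 4 <= m]. The deviation is thus at most [- m * n / (4 * a)]. *)
Lemma poor_dev (I V : finType) (e : rel V) (N k : nat) (x : {ffun I -> V}) (i : I) :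
    irreflexive e -> (4 * N + 4 <= #|I|)%N ->
    (forall v, (N + 1) * #|V| <= N * k * outdegree e v)%N -> poor e N k x i ->
  (((#|I| * #|V|) ^ 2)%N%:Z <= ((4 * (N * k)) ^ 2)%N%:Z *
    (\sum_(j | j != i) edge_dev e (x i) (x j)) ^+ 2).
Proof.
move=> irr mN deg bad; rewrite sum_edge_dev_sample //.
have := deg (x i); move: bad mN; rewrite /poor.
move: (outdegree _ _) (sample_outdegree _ _ _) #|V| #|I| (N * k)%N => d D n m a bad mN degi.
move: (erefl (n%:Z * D%:Z - m.-1%:Z * d%:Z)); move: {1 3}(n%:Z * D%:Z - m.-1%:Z * d%:Z) => S SE.
have H : (m%:Z * n%:Z <= (4 * a)%N%:Z * - S).
  case: m mN bad SE => [|m] mN bad /= SE; first by lia.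
  have h1 : (2 * a * D * n <= ((2 * N + 1) * m.+1) * n)%N.
    by rewrite leq_mul2r (ltnW bad) orbT.
  have h2 : ((N + 1) * n * m <= a * d * m)%N by rewrite leq_mul2r degi orbT.
  have h3 : ((4 * N + 4) * n <= m.+1 * n)%N by rewrite leq_mul2r mN orbT.
  have key : (m.+1 * n + 4 * (a * D * n) <= 4 * (a * d * m))%N.
    (* Expanding into common monomials leaves an inequality that is linear in them. *)
    have E1 : (2 * a * D * n = 2 * (a * D * n))%N by ring.
    have E2 : ((2 * N + 1) * m.+1 * n = 2 * (N * m * n) + 2 * (N * n) + m * n + n)%N.
      by rewrite -addn1; ring.
    have E3 : ((N + 1) * n * m = N * m * n + m * n)%N by ring.
    have E4 : ((4 * N + 4) * n = 4 * (N * n) + 4 * n)%N by ring.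
    have E5 : (m.+1 * n = m * n + n)%N by rewrite -addn1; ring.
    rewrite E5; move: h1 h2 h3; rewrite E1 E2 E3 E4 E5.
    move: (a * D * n)%N (a * d * m)%N (N * m * n)%N (N * n)%N (m * n)%N => p q r s t.
    clear; lia.
  have -> : (4 * a)%N%:Z * - S = 4%:Z * (a * d * m)%N%:Z - 4%:Z * (a * D * n)%N%:Z.
    by rewrite SE !PoszM; ring.
  rewrite -!PoszM lerBrDr -PoszD lez_nat; exact: key.
have H0 : 0 <= m%:Z * n%:Z by rewrite -PoszM.
have -> : ((m * n) ^ 2)%N%:Z = (m%:Z * n%:Z) ^+ 2 by rewrite -PoszM.
have -> : ((4 * a) ^ 2)%N%:Z * S ^+ 2 = ((4 * a)%N%:Z * - S) ^+ 2.
  by rewrite exprMn sqrrN.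
by rewrite lerXn2r // nnegrE; apply: le_trans H.
Qed.

(** Chebyshev's inequality, summed over the indices: the mean number of poor indices is bounded
    independently of the sample size. *)
Lemma few_poor (I V : finType) (e : rel V) (N k : nat) :
    irreflexive e -> (0 < #|V|)%N -> (4 * N + 4 <= #|I|)%N ->
    (forall v, (N + 1) * #|V| <= N * k * outdegree e v)%N ->
  (\sum_(x : {ffun I -> V}) #|[set i | poor e N k x i]|
    <= (4 * (N * k)) ^ 2 * #|V| ^ #|I|)%N.
Proof.
move=> irr V0 mN deg.
have I0 : (0 < #|I|)%N by lia.
pose K := ((#|I| * #|V|) ^ 2)%N.
have K0 : (0 < K)%N by rewrite expn_gt0 muln_gt0 I0 V0.
rewrite -(leq_pmul2r K0).
have main i : (\sum_(x : {ffun I -> V}) (poor e N k x i * K) <=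
    (4 * (N * k)) ^ 2 * (#|I| * #|V| ^ 2 * #|V| ^ #|I|))%N.
  rewrite -lez_nat PoszM (big_morph Posz PoszD (erefl _)).
  apply: (@le_trans _ _ (\sum_(x : {ffun I -> V}) ((4 * (N * k)) ^ 2)%N%:Z *
    (\sum_(j | j != i) edge_dev e (x i) (x j)) ^+ 2)).
    apply: ler_sum => x _; case px: (poor e N k x i); last first.
      by rewrite mul0n mulr_ge0 // sqr_ge0.
    by rewrite mul1n; apply: poor_dev.
  by rewrite -mulr_sumr ler_wpM2l //; apply: second_moment.
have -> : ((\sum_(x : {ffun I -> V}) #|[set i | poor e N k x i]|) * K =
    \sum_(i : I) \sum_(x : {ffun I -> V}) (poor e N k x i * K))%N.
  rewrite exchange_big /= big_distrl; apply: eq_bigr => x _ /=.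
  by rewrite -big_distrl /= sum_bool_card.
apply: (@leq_trans (\sum_(i : I) (4 * (N * k)) ^ 2 * (#|I| * #|V| ^ 2 * #|V| ^ #|I|))%N).
  by apply: leq_sum => i _; apply: main.
rewrite sum_nat_const /K.
move: ((4 * (N * k)) ^ 2)%N (#|V| ^ #|I|)%N #|V| #|I| => b c n m.
by rewrite expnMn -[(m ^ 2)%N]/(m * m)%N; apply/eq_leq; ring.
Qed.

(** Markov's inequality. The mean number of poor indices is at most [16 * (N * k) ^ 2], so the size
    [128 * (N * k) ^ 3] leaves at most half of the samples with more than [#|I| / (4 * N * k)] poor
    indices. *)
Lemma many_good (I V : finType) (e : rel V) (N k : nat) :
    irreflexive e -> (0 < #|V|)%N -> (0 < N)%N -> (0 < k)%N ->
    #|I| = (128 * (N * k) ^ 3)%N ->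
    (forall v, (N + 1) * #|V| <= N * k * outdegree e v)%N ->
  (#|V| ^ #|I| <= 2 * #|[set x : {ffun I -> V} |
      4 * (N * k) * #|[set i | poor e N k x i]| <= #|I|]|)%N.
Proof.
move=> irr V0 N0 k0 IE deg.
set G := [set x | _].
have NE : #|{ffun I -> V}| = (#|V| ^ #|I|)%N by rewrite card_ffun.
have a0 : (0 < N * k)%N by rewrite muln_gt0 N0.
have mN : (4 * N + 4 <= #|I|)%N.
  rewrite IE; have : (N <= N * k)%N by rewrite leq_pmulr.
  have : (N * k <= (N * k) ^ 3)%N by rewrite -[X in (X <= _)%N]expn1 leq_pexp2l.
  by lia.
have few := few_poor I V e N k irr V0 mN deg.
have : (#|I| * #|~: G| <= 4 * (N * k) * ((4 * (N * k)) ^ 2 * #|V| ^ #|I|))%N.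
  apply: leq_trans (leq_mul (leqnn _) few).
  rewrite mulnC -sum_nat_const big_distrr /= big_mkcond; apply: leq_sum => x _.
  by rewrite !inE -ltnNge; case: ltnP => // /ltnW.
rewrite mulnA -[(4 * (N * k) * _ ^ 2)%N]expnS expnMn.
have : (#|G| + #|~: G| = #|V| ^ #|I|)%N by rewrite cardsC.
move=> <-; rewrite IE.
have : (0 < (N * k) ^ 3)%N by rewrite expn_gt0 a0.
move: ((N * k) ^ 3)%N #|G| #|~: G| => c g h c0.
rewrite -[(4 ^ 3)%N]/64%N => H.
have : (c * (2 * h) <= c * (g + h))%N by lia.
by rewrite leq_pmul2l //; lia.
Qed.

(** Deleting the poor indices lowers an outdegree by at most [#|I| / (4 * N * k)], half of the
    surplus over [#|I| / k] that the other indices have. So [closed_walk] applies to what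
    remains. *)
Lemma good_sample_cycle (I V : finType) (e : rel V) (N k l : nat) (x : {ffun I -> V}) :
    (0 < #|I|)%N -> (0 < N)%N -> (0 < k)%N -> (0 < l)%N ->
    (forall p, 0 < p -> p < k -> p %| l)%N -> ((3 * k) ^ 2 <= l)%N ->
    (4 * (N * k) * #|[set i | poor e N k x i]| <= #|I|)%N ->
  exists c : l.-tuple I, cycle e (map x c).
Proof.
move=> I0 N0 k0 l0 divl hl good.
have a0 : (0 < N * k)%N by rewrite muln_gt0 N0.
set P := [set i | _] in good.
have PI : (#|P| + #|~: P| = #|I|)%N by rewrite cardsC.
have [||y yl] := closed_walk I (relpre x e) k l (~: P) _ _ divl hl.
- rewrite -card_gt0; move: PI good a0; rewrite -mulnA.
  move: (N * k)%N #|P| #|~: P| #|I| I0 => a p q m m0 pq good a0.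
  have : (p <= a * p)%N by rewrite leq_pmull.
  by lia.
- move=> i; rewrite !inE /poor -leqNgt => rich.
  have D : (sample_outdegree e x i <= #|P| + outdegree_in (relpre x e) (~: P) i)%N.
    rewrite /sample_outdegree /outdegree /outdegree_in.
    apply: leq_trans (leq_card_setU _ _); apply: subset_leq_card.
    by apply/subsetP => j; rewrite !inE => ->; rewrite andbT orbN.
  have le_I : (#|~: P| <= #|I|)%N by rewrite -PI leq_addl.
  apply: leq_ltn_trans le_I _.
  have N4 : (0 < 4 * N)%N by rewrite muln_gt0.
  rewrite -(ltn_pmul2l N4); clear N4 PI; clearbody P.
  move: rich good D I0.
  move: (sample_outdegree e x i) (outdegree_in _ _ _) #|P| #|I| => D f p m rich good Dpf m0.
  have E : (2 * (N * k) * D <= 2 * (N * k) * (p + f))%N by rewrite leq_mul2l Dpf orbT.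
  have -> : (4 * N * (k * f) = 4 * (N * k * f))%N by ring.
  have F : (2 * (N * k) * (p + f) = 2 * (N * k * p) + 2 * (N * k * f))%N by ring.
  have G : ((2 * N + 1) * m = 2 * (N * m) + m)%N by ring.
  have H : (4 * N * m = 4 * (N * m))%N by ring.
  have J : (2 * (N * k) * D = 2 * (N * k * D))%N by ring.
  have K : (4 * (N * k) * p = 4 * (N * k * p))%N by ring.
  rewrite H; move: rich good E; rewrite F G J K.
  move: (N * k * D)%N (N * k * p)%N (N * k * f)%N (N * m)%N => *.
  by lia.
have [c szc cyc] := walk_cycle _ _ _ _ l0 yl.
have szc' : size c == l by apply/eqP.
by exists (Tuple szc'); rewrite /= cycle_map.
Qed.

(** Fixes a single pattern shared by a positive proportion of all samples, as [blowup] requires. *)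
Lemma pigeonhole_pattern (C : finType) (X : finType) (G : {set X}) (P : C -> pred X) (K : nat) :
    (0 < K)%N -> (K <= 2 * #|G|)%N -> (forall x, x \in G -> exists c, P c x) ->
  exists c, (K <= 2 * #|C| * #|[set x | P c x]|)%N.
Proof.
move=> K0 KG GP.
have cover : (#|G| <= \sum_c #|[set x | P c x]|)%N.
  apply: (@leq_trans (\sum_c \sum_x P c x)%N); last first.
    by apply: leq_sum => c _; rewrite sum_bool_card.
  rewrite exchange_big -sum1_card big_mkcond; apply: leq_sum => x _ /=.
  case: ifP => // /GP[c cx]; by rewrite (bigD1 c) //= cx.
have /existsP[c Hc] : [exists c, (K <= 2 * #|C| * #|[set x | P c x]|)%N].
  apply: contraT => /existsPn small.
  have : (#|C| * K <= \sum_(c : C) 2 * #|C| * #|[set x | P c x]|)%N.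
    rewrite -big_distrr /= [(2 * _)%N]mulnC -mulnA leq_mul2l; apply/orP; right.
    by apply: leq_trans KG _; rewrite leq_mul2l cover orbT.
  have G0 : (0 < #|G|)%N by lia.
  (* A good sample shows that [C] is nonempty, which makes the summed inequality strict. *)
  have /card_gt0P[x xG] := G0; have [c0 _] := GP x xG.
  rewrite leqNgt -sum_nat_const.
  suff -> : (\sum_(c : C) 2 * #|C| * #|[set x | P c x]| < \sum_(c : C) K)%N by [].
  rewrite (bigD1 c0) //= [X in (_ < X)%N](bigD1 c0) //= -addSn; apply: leq_add.
    by rewrite ltnNge small.
  by apply: leq_sum => c _; apply: ltnW; rewrite ltnNge small.
by exists c.
Qed.

(** * Large digraphs with large outdegrees *)

Lemma min_outdegree_le (T : finType) (e : rel T) v : (min_outdegree e <= outdegree e v)%N.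
Proof.
rewrite /min_outdegree; have := mem_index_enum v.
elim: (index_enum T) => //= a r IH; rewrite inE big_cons geq_min.
by case/orP => [/eqP->|/IH->]; rewrite ?leqnn ?orbT.
Qed.

(** The sample size and the number of patterns depend only on [N], [k] and [l], so the threshold
    from [blowup] is uniform in the digraph. *)
Lemma cycle_of_outdegree (N k l : nat) :
    (0 < N)%N -> (0 < k)%N -> (forall p, 0 < p -> p < k -> p %| l)%N ->
    ((3 * k) ^ 2 <= l)%N ->
  exists n0, forall (V : finType) (e : rel V), irreflexive e -> (n0 <= #|V|)%N ->
    (forall v, (N + 1) * #|V| <= N * k * outdegree e v)%N ->
    exists2 y, size y = l & ucycle e y.
Proof.
move=> N0 k0 divl hl.
have l0 : (0 < l)%N by apply: leq_trans hl; rewrite expn_gt0 muln_gt0 k0.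
pose I : finType := 'I_(128 * (N * k) ^ 3).
have IE : #|I| = (128 * (N * k) ^ 3)%N by rewrite card_ord.
have I0 : (0 < #|I|)%N by rewrite IE muln_gt0 expn_gt0 muln_gt0 N0 k0.
have M0 : (0 < 2 * #|{: l.-tuple I}|)%N by rewrite card_tuple muln_gt0 expn_gt0 I0.
have [n0 H] := blowup I l _ l0 M0.
exists n0.+1 => V e irr nV deg.
have V0 : (0 < #|V|)%N by apply: leq_trans nV.
have [c dc] := pigeonhole_pattern _ _ _
  (fun (c : l.-tuple I) (x : {ffun I -> V}) => cycle e (map x c)) (#|V| ^ #|I|)
  ltac:(by rewrite expn_gt0 V0) (many_good I V e N k irr V0 N0 k0 IE deg)
  (fun x xG => good_sample_cycle I V e N k l x I0 N0 k0 l0 divl hl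
    ltac:(by rewrite inE in xG)).
have [X sX XQ] := H V _ (ltnW nV) dc.
have [|||y sy cy] := blowup_cycle I V e c X irr; rewrite ?size_tuple //.
- by move=> i; rewrite sX.
- by move=> z /XQ; rewrite inE.
by exists y; rewrite // sy size_tuple.
Qed.

Theorem theorem1p3 (R : realType) (k l : nat)
    (hk : (7 <= k)%N) (hl : (10 ^ 7 * k ^ 6 <= l)%N)
    (hkl : ~~ (k %| l)%N)
    (hmin : forall j : nat, (2 < j)%N -> (j < k)%N -> (j %| l)%N)
    (eta : R) (heta : 0 < eta) :
  exists n1 : nat, forall (T : finType) (e : rel T),
    oriented_graph e -> (n1 <= #|T|)%N ->
    (1 + eta) * #|T|%:R / k%:R <= (min_semidegree e)%:R ->
    has_directed_cycle e l.
Proof.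
have k0 : (0 < k)%N by apply: leq_trans hk.
have divl p : (0 < p)%N -> (p < k)%N -> (p %| l)%N.
  (* The divisor 2 is not covered by [hmin], but it divides 4, which is below [k]. *)
  case: p => [|[|[|p]]] // _ pk.
    by apply: dvdn_trans (hmin 4 _ _) => //; apply: leq_trans hk.
  exact: hmin.
have hl' : ((3 * k) ^ 2 <= l)%N.
  apply: leq_trans hl; rewrite expnMn; apply: leq_mul; last by rewrite leq_pexp2l.
  by apply: (@leq_trans (10 ^ 1)%N) => //; rewrite leq_pexp2l.
have l0 : (0 < l)%N by apply: leq_trans hl'; rewrite expn_gt0 muln_gt0 k0.
(* With [N] above [1 / eta], the factor [1 + eta] is at least [(N + 1) / N], the integral form of
   the degree condition. *)
pose N := Num.bound eta^-1.
have NB : eta^-1 < N%:R by apply: archi_boundP; rewrite invr_ge0 ltW.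
have N0 : (0 < N)%N by rewrite -(ltr0n R); apply: lt_trans NB; rewrite invr_gt0.
have [n0 H] := cycle_of_outdegree N k l N0 k0 divl hl'.
exists n0 => T e [irr _] nT deg.
have [|y sy cy] := H T e irr nT; last by exists y.
move=> v; rewrite -(ler_nat R) natrM natrD !natrM.
have dv : (min_semidegree e)%:R <= (outdegree e v)%:R :> R.
  rewrite ler_nat; apply: leq_trans (geq_minl _ _) _; exact: min_outdegree_le.
have kR : 0 < k%:R :> R by rewrite ltr0n.
have {}deg : (1 + eta) * #|T|%:R <= (outdegree e v)%:R * k%:R.
  by rewrite -ler_pdivrMr //; apply: le_trans deg dv.
have NR : 0 < N%:R :> R by rewrite ltr0n.
have Neta : 1 <= N%:R * eta by rewrite -ler_pdivrMr // mul1r ltW.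
have T0 : 0 <= #|T|%:R :> R by [].
apply: (@le_trans _ _ (N%:R * ((1 + eta) * #|T|%:R))).
  by rewrite mulrA ler_wpM2r // mulrDr mulr1 lerD2l.
by rewrite -mulrA ler_pM2l // [X in _ <= X]mulrC.
Qed.
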